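(* Let $E$ and $E'$ be second countable Stone spaces, each with at least four points, and let $\Phi\colon\mathscr{C}(E)\to\mathscr{C}(E')$ be a graph isomorphism. Then there exists a homeomorphism $f\colon E\to E'$ inducing $\Phi$, i.e. $\Phi(U\sqcup V)=f(U)\sqcup f(V)$ for every non-peripheral cut $U\sqcup V$ of $E$.
   Context: A Stone space is a compact, Hausdorff, totally disconnected space. A cut of $E$ is an unordered partition of $E$ into two disjoint clopen sets $U,V$, written $U\sqcup V$; it is non-peripheral if each of $U,V$ contains at least two points. Two cuts $U\sqcup V$, $U'\sqcup V'$ cross if all four sets $U\cap U'$, $U\cap V'$, $V\cap U'$, $V\cap V'$ are nonempty; otherwise they are compatible. The complex of cuts $\mathscr{C}(E)$ is the simplicial graph whose vertices are the non-peripheral cuts of $E$, with edges between distinct compatible cuts. *)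

(* Defs.v *)
From HB Require Import structures.
From mathcomp Require Import all_boot all_order.
From mathcomp Require Import all_classical all_reals all_analysis.
Set Implicit Arguments. Unset Strict Implicit. Unset Printing Implicit Defensive.
Local Open Scope classical_set_scope.

Definition stone_space (T : topologicalType) : Prop :=
  [/\ compact [set: T], hausdorff_space T & totally_disconnected [set: T]].

Definition at_least_four_points (T : Type) : Prop :=
  exists a b c d : T,
    [/\ a <> b, a <> c, a <> d, b <> c & (b <> d /\ c <> d)].

Definition at_least_two_points (T : Type) (A : set T) : Prop :=
  exists x y, [/\ A x, A y & x <> y].

(* A cut of T: the unordered partition {U, V} of T into two disjoint
   clopen sets, represented as the two-element family [set U; V]. *)
Definition is_cut (T : topologicalType) (P : set (set T)) : Prop :=
  exists U V : set T,
    [/\ clopen U, clopen V, U `&` V = set0, U `|` V = [set: T]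
      & P = [set U; V]].

Definition nonperipheral_cut (T : topologicalType) (P : set (set T)) : Prop :=
  is_cut P /\ (forall A, P A -> at_least_two_points A).

Definition cut_vertex (T : topologicalType) :=
  {P : set (set T) | nonperipheral_cut P}.

Definition cuts_cross (T : topologicalType) (P Q : set (set T)) : Prop :=
  forall A B, P A -> Q B -> A `&` B !=set0.

Definition cut_adj (T : topologicalType) (P Q : cut_vertex T) : Prop :=
  P <> Q /\ ~ cuts_cross (proj1_sig P) (proj1_sig Q).

Definition cut_graph_iso (T T' : topologicalType)
  (Phi : cut_vertex T -> cut_vertex T') : Prop :=
  bijective Phi /\ (forall P Q, cut_adj P Q <-> cut_adj (Phi P) (Phi Q)).

Definition homeomorphism (T T' : topologicalType) (f : T -> T') : Prop :=
  exists g : T' -> T, [/\ cancel f g, cancel g f, continuous f & continuous g].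

Definition cut_image (T T' : Type) (f : T -> T') (P : set (set T)) :
  set (set T') := [set f @` A | A in P].

(* Main.v *)
Require Import Defs.
From HB Require Import structures.
From mathcomp Require Import all_boot all_order.
From mathcomp Require Import all_classical all_reals all_analysis.
Local Open Scope classical_set_scope.

(** A cut [U | ~` U] separates the cuts compatible with it into those nested in
    [U] and those nested in [~` U]. Cuts on opposite sides never cross, whereas
    two cuts on the same side cross or are both crossed by a third cut on that
    side, so a graph isomorphism carries the two sides of a cut to the two sides
    of its image. With at least five points this orients the isomorphism into a
    bijection of nonperipheral clopen sets that preserves inclusion and
    complement, and then also the nonemptiness of triple intersections. With four
    points there are no edges, and cuts are oriented by matching a base point of
    [E] with one of [E']. In both cases the image of [x] is the unique point
    common to the images of all nonperipheral clopen sets containing [x]. *)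

Set Implicit Arguments.
Unset Strict Implicit.

(** * Stone spaces and nonperipheral clopen sets *)

Lemma compact_directed_closed (T : topologicalType) (G : set (set T)) :
  compact [set: T] -> G !=set0 ->
  (forall A, G A -> closed A /\ A !=set0) ->
  (forall A B, G A -> G B -> exists2 C, G C & C `<=` A `&` B) ->
  exists p, forall A, G A -> A p.
Proof.
move=> cT G0 Gcl Gdir.
have FF : ProperFilter (filter_from G id).
  apply: filter_from_proper; last by move=> A /Gcl [].
  exact: filter_from_filter.
have [|p [_ clp]] := cT _ FF; first exact: filterT.
exists p => A GA; apply: (Gcl A GA).1 => B nB.
by apply: clp nB; exists A.
Qed.

(** If every clopen [D] containing [x] met the complement of [W], the traces of these [D] outside
    [W] would form a directed family of nonempty closed sets. A common point would lie in the
    quasicomponent of [x] but outside [W]. *)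
Lemma quasicomponent_sub_open (T : topologicalType) (x : T) (W : set T) :
  compact [set: T] -> open W ->
  \bigcap_(D in [set D | clopen D /\ D x]) D `<=` W ->
  exists D, [/\ clopen D, D x & D `<=` W].
Proof.
move=> cT oW QW; apply: contrapT => noD.
pose G := [set A | exists D, [/\ clopen D, D x & A = D `&` ~` W]].
have [| | |p Gp] := @compact_directed_closed T G cT.
- by exists (setT `&` ~` W); exists setT; split => //; exact: clopenT.
- move=> _ [D [[oD cD] Dx ->]]; split.
    by apply: closedI => //; exact: open_closedC.
  apply: contrapT => DW; apply: noD; exists D; split => // z Dz.
  by apply: contrapT => nWz; apply: DW; exists z.
- move=> _ _ [D [cD Dx ->]] [D' [cD' Dx' ->]].
  exists (D `&` D' `&` ~` W); last by move=> z [[? ?] ?].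
  by exists (D `&` D'); split => //; exact: clopenI.
have Gt : G (setT `&` ~` W).
  by exists setT; split => //; exact: clopenT.
have [_] := Gp _ Gt; apply; apply: QW => D [cD Dx].
by have [] := Gp (D `&` ~` W); first by exists D.
Qed.

(** A relatively clopen part [B] of the quasicomponent [Q] lies in an open [O] whose closure meets
    [Q] only in [B]. Some clopen [D] containing [x] avoids the boundary of [O], so [O] cuts [D] into
    two clopen pieces, and the piece containing [x] contains all of [Q]. *)
Lemma quasicomponent_connected (T : topologicalType) (x : T) :
  compact [set: T] -> hausdorff_space T ->
  connected (\bigcap_(D in [set D | clopen D /\ D x]) D).
Proof.
move=> cT hT; set Q := \bigcap_(_ in _) _ => B [b Bb] [C oC BC] [F cF BF].
have cQ : closed Q by apply: closed_bigI => D [[]].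
have cB : closed B by rewrite BF; apply: closedI.
have [ |W BW clW] := compact_normal hT cT cB (t := ~` (Q `&` ~` C)).
  move=> z Bz; apply: open_nbhs_nbhs; split.
    by apply: closed_openC; apply: closedI => //; apply: open_closedC.
  by move: Bz; rewrite BC => -[? ?] [].
pose O := W°; have oO : open O by exact: open_interior.
have BO : B `<=` O by [].
have OW : O `<=` W by exact: interior_subset.
have OQ z : closure O z -> Q z -> B z.
  move=> Oz Qz; have : (~` (Q `&` ~` C)) z by apply: clW; apply: closureS Oz.
  by move=> nQC; rewrite BC; split => //; apply: contrapT => nC; apply: nQC.
have oV : open (~` closure O) by apply: closed_openC; exact: closed_closure.
have [||D [[oD cD] Dx DW]] := @quasicomponent_sub_open T x (O `|` ~` closure O) cT.
- exact: openU.
- move=> z Qz; have [Oz|] := pselect (closure O z); last by right.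
  by left; apply: BO; exact: OQ.
have DO : D `&` O = D `&` closure O.
  apply/seteqP; split => z [Dz Oz]; split => //; first exact: subset_closure.
  by have [|/(_ Oz)] := DW z Dz.
apply/seteqP; split => [z|z Qz]; first by rewrite BC => -[].
have [Ox|nOx] := pselect (O x).
  have [] // : (D `&` O) z; last first.
    by move=> _ Oz; apply: OQ Qz; exact: subset_closure.
  apply: Qz; split; last by [].
  by split; [exact: openI|rewrite DO; apply: closedI => //; exact: closed_closure].
(* Here the piece outside [O] would contain [Q], hence [b], which lies in [B] and so in [O]. *)
have [_ []] : (D `&` ~` O) b; last exact: BO.
have Qb : Q b by move: Bb; rewrite BC => -[].
apply: Qb; split; last by [].
split; last by apply: closedI => //; exact: open_closedC.
suff -> : D `&` ~` O = D `&` ~` closure O by apply: openI.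
apply/seteqP; split => y [Dy nOy]; split => //.
  by have [|] := DW y Dy.
by move=> Oy; apply: nOy; exact: subset_closure.
Qed.

(** A point that no clopen set separates from [x] lies in the quasicomponent of [x], which is
    connected and hence a singleton. *)
Lemma stone_zero_dimensional (T : topologicalType) :
  stone_space T -> zero_dimensional T.
Proof.
move=> [cT hT tdT] x y /eqP xy; apply: contrapT => nsep; apply: xy.
suff : connected_component setT x y by rewrite tdT // => ->.
exists (\bigcap_(D in [set D | clopen D /\ D x]) D).
  by split=> // [D []//|]; exact: quasicomponent_connected.
move=> D [cD Dx]; apply: contrapT => nDy.
by apply: nsep; exists D.
Qed.

Definition nonperipheral (T : topologicalType) (U : set T) : Prop :=
  [/\ clopen U, at_least_two_points U & at_least_two_points (~` U)].

(** Phrased with lists so that it directly yields a point different from finitely many named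
    ones. *)
Definition card_gt (T : eqType) (n : nat) : Prop :=
  forall s : seq T, (size s <= n)%N -> exists x, x \notin s.

Lemma four_points_card_gt (T : topologicalType) :
  at_least_four_points T -> card_gt T 3.
Proof.
move=> [a [b [c [d [/eqP ab /eqP ac /eqP ad /eqP bc [/eqP bd /eqP cd]]]]]] s s3.
apply: contrapT => all_s.
have : (size [:: a; b; c; d] <= size s)%N.
  apply: uniq_leq_size; first by rewrite /= !inE !negb_or ab ac ad bc bd cd.
  by move=> x _; apply: contrapT => /negP xs; apply: all_s; exists x.
by move=> /leq_trans /(_ s3).
Qed.

(** Only points on opposite sides are assumed distinct, so taking [y = b] separates a pair from a
    single point. *)
Lemma clopen_separates_pairs (T : topologicalType) (x a y b : T) :
  zero_dimensional T -> x <> y -> x <> b -> a <> y -> a <> b ->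
  exists U, clopen U /\ [/\ U x, U a, ~ U y & ~ U b].
Proof.
move=> zT /eqP/zT[U1 [c1 x1 y1]] /eqP/zT[U2 [c2 x2 b2]].
move=> /eqP/zT[U3 [c3 a3 y3]] /eqP/zT[U4 [c4 a4 b4]].
exists ((U1 `&` U2) `|` (U3 `&` U4)); split.
  by apply: clopenU; apply: clopenI.
by split; [left|right|case=> -[]|case=> -[]].
Qed.

(** Four points allow one further point to be placed on each side of the separating clopen set. *)
Lemma nonperipheral_separates (T : topologicalType) (x y : T) :
  stone_space T -> card_gt T 3 -> x <> y ->
  exists U, [/\ nonperipheral U, U x & ~ U y].
Proof.
move=> /stone_zero_dimensional zT T3 xy.
have [//|a] := T3 [:: x; y]; rewrite !inE negb_or => /andP[/eqP ax /eqP ay].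
have [//|b] := T3 [:: x; y; a].
rewrite !inE !negb_or => /and3P[/eqP bx /eqP by_ /eqP ba].
have [||||U [cU [Ux Ua nUy nUb]]] := @clopen_separates_pairs T x a y b zT;
  try congruence.
exists U; split=> //; split=> //.
- by exists x, a; split => //; congruence.
- by exists y, b; split => //; congruence.
Qed.

Lemma nonperipheralC (T : topologicalType) (U : set T) :
  nonperipheral U -> nonperipheral (~` U).
Proof. by move=> [cU U2 V2]; split; rewrite ?setCK //; apply: clopenC. Qed.

Lemma nonperipheral_nonempty (T : topologicalType) (U : set T) :
  nonperipheral U -> U !=set0.
Proof. by case=> _ [x [y [Ux _ _]]] _; exists x. Qed.

Lemma at_least_two_points_subset (T : Type) (A B : set T) :
  A `<=` B -> at_least_two_points A -> at_least_two_points B.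
Proof. by move=> AB [x [y [Ax Ay xy]]]; exists x, y; split => //; exact: AB. Qed.

Lemma nonperipheralI (T : topologicalType) (U V : set T) :
  nonperipheral U -> nonperipheral V -> at_least_two_points (U `&` V) ->
  nonperipheral (U `&` V).
Proof.
move=> [cU _ U2] [cV _ _] UV2; split=> //; first exact: clopenI.
by apply: at_least_two_points_subset U2 => x nUx [].
Qed.

Lemma nonperipheralU (T : topologicalType) (U V : set T) :
  nonperipheral U -> nonperipheral V -> at_least_two_points (~` (U `|` V)) ->
  nonperipheral (U `|` V).
Proof.
move=> [cU U2 _] [cV _ _] UV2; split=> //; first exact: clopenU.
by apply: at_least_two_points_subset U2 => x Ux; left.
Qed.

(** * From a correspondence of clopen sets to a homeomorphism *)

(** Triples serve to locate points: when two images meet in a single point, this forces every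
    further image to contain it. *)
Definition triple_preserving (T T' : Type) (R : set T -> set T' -> Prop) : Prop :=
  forall U V W U' V' W', R U U' -> R V V' -> R W W' ->
  U `&` V `&` W !=set0 -> U' `&` V' `&` W' !=set0.

(** A relation rather than a map, so that the inverse is the same relation with its arguments
    swapped. *)
Record side_correspondence (T T' : topologicalType)
    (R : set T -> set T' -> Prop) : Prop := SideCorrespondence {
  side_np : forall U U', R U U' -> nonperipheral U /\ nonperipheral U';
  side_total : forall U, nonperipheral U -> exists U', R U U';
  side_surj : forall U', nonperipheral U' -> exists U, R U U';
  side_compl : forall U U', R U U' -> R (~` U) (~` U') }.

Lemma side_correspondence_sym (T T' : topologicalType)
    (R : set T -> set T' -> Prop) :
  side_correspondence R -> side_correspondence (fun U' U => R U U').
Proof.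
by case=> np tot surj C; split => // [U U' /np [] //|U U' /C].
Qed.

(** Inclusion of [U] in [V] means that [U] misses the complement of [V]; repeating that complement
    turns the pair into a triple. *)
Lemma triple_preserving_subset (T T' : topologicalType)
    (R : set T -> set T' -> Prop) (U V : set T) (U' V' : set T') :
  side_correspondence R -> triple_preserving (fun U' U => R U U') ->
  R U U' -> R V V' -> U `<=` V -> U' `<=` V'.
Proof.
move=> RC R3 RU RV UV x Ux; apply: contrapT => nVx.
have RnV := side_compl RC RV.
have [|z [[Uz nVz] _]] := R3 _ _ _ _ _ _ RU RnV RnV; first by exists x.
exact: nVz (UV z Uz).
Qed.

(* If two members of [R] meet only in [x], their images meet in one point, which
   is the image of [x]; otherwise the sides containing [x] are closed under
   intersection and compactness of [T'] applies. *)
Lemma side_correspondence_point (T T' : topologicalType)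
    (R : set T -> set T' -> Prop) (x : T) :
  stone_space T -> stone_space T' -> card_gt T 3 ->
  side_correspondence R ->
  triple_preserving R -> triple_preserving (fun U' U => R U U') ->
  exists y, forall U U', R U U' -> U x -> U' y.
Proof.
move=> sT sT' T3 RC R3 R3'; have [cT' _ _] := sT'.
have meet2 U V U' V' : R U U' -> R V V' -> U x -> V x ->
    U' `&` V' !=set0.
  move=> RU RV Ux Vx.
  by have [|y [Uy Vy]] := R3 _ _ _ _ _ _ RU RV RV; [exists x|exists y; case: Uy].
have [[U [V [U' [V' [RU RV Ux Vx UV1]]]]]|no1] := pselect (exists U V U' V',
    [/\ R U U', R V V', U x, V x & ~ at_least_two_points (U `&` V)]).
  have [y [Uy Vy]] := meet2 _ _ _ _ RU RV Ux Vx.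
  (* Two common points would make the intersection of [U'] and [V'] nonperipheral; the side [W] it
     comes from would lie in both [U] and [V] and carry two points. *)
  have UV1' : ~ at_least_two_points (U' `&` V').
    have [_ NU'] := side_np RC RU; have [_ NV'] := side_np RC RV.
    move=> UV2; have NUV := nonperipheralI NU' NV' UV2.
    have [W RW] := side_surj RC NUV; apply: UV1.
    have [[_ W2 _] _] := side_np RC RW.
    have RC' := side_correspondence_sym RC.
    apply: at_least_two_points_subset W2 => z Wz; split.
      by apply: (triple_preserving_subset RC' R3 RW RU _ Wz) => ? [].
    by apply: (triple_preserving_subset RC' R3 RW RV _ Wz) => ? [].
  exists y => W W' RW Wx.
  have [|z [[Uz Vz] Wz]] := R3 _ _ _ _ _ _ RU RV RW; first by exists x.
  suff -> : y = z by [].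
  by apply: contrapT => yz; apply: UV1'; exists y, z.
have [|A [U [RU Ux]]|A B [U [RU Ux]] [V [RV Vx]]|y Gy] :=
    @compact_directed_closed T' [set U' | exists U, R U U' /\ U x] cT'.
- have [//|z] := T3 [:: x]; rewrite inE => /eqP zx.
  have [U [NU Ux _]] := nonperipheral_separates sT T3 (nesym zx).
  by have [U' RU] := side_total RC NU; exists U', U.
- have [_ NA] := side_np RC RU; split; last exact: nonperipheral_nonempty.
  by case: NA => -[].
- have UV2 : at_least_two_points (U `&` V).
    by apply: contrapT => UV1; apply: no1; exists U, V, A, B.
  have [NU _] := side_np RC RU; have [NV _] := side_np RC RV.
  have [W RW] := side_total RC (nonperipheralI NU NV UV2).
  exists W; first by exists (U `&` V).
  move=> z Wz; split.
    by apply: (triple_preserving_subset RC R3' RW RU _ Wz) => ? [].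
  by apply: (triple_preserving_subset RC R3' RW RV _ Wz) => ? [].
by exists y => U U' RU Ux; apply: Gy; exists U.
Qed.

Lemma side_correspondence_map (T T' : topologicalType)
    (R : set T -> set T' -> Prop) :
  stone_space T -> stone_space T' -> card_gt T 3 ->
  side_correspondence R ->
  triple_preserving R -> triple_preserving (fun U' U => R U U') ->
  exists f : T -> T', forall U U' x, R U U' -> U x <-> U' (f x).
Proof.
move=> sT sT' T3 RC R3 R3'.
have [f fP] := choice (fun x => side_correspondence_point x sT sT' T3 RC R3 R3').
exists f => U U' x RU; split; first exact: fP.
move=> U'fx; apply: contrapT => nUx.
by have /(_ U'fx) := fP _ _ _ (side_compl RC RU) nUx.
Qed.

Lemma side_map_continuous (T T' : topologicalType)
    (R : set T -> set T' -> Prop) (f : T -> T') :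
  stone_space T' -> card_gt T' 3 -> side_correspondence R ->
  (forall U U' x, R U U' -> U x <-> U' (f x)) -> continuous f.
Proof.
move=> sT' T3 RC fP x; have [cT' hT' _] := sT'.
(* In a compact Hausdorff space a filter converges to its only cluster point. A second cluster point
   [y] is ruled out by a nonperipheral [W] separating it from [f x], since [W] pulls back to an open
   set. *)
apply: (compact_cluster_set1 hT' cT'); [exact: filterT|exact: filterT|].
apply/seteqP; split => [y cly|y ->]; last first.
  by move=> A B /nbhs_singleton /= Afx /nbhs_singleton By; exists (f x).
apply: contrapT => /= yfx.
have [W [NW Wfx nWy]] := nonperipheral_separates sT' T3 (nesym yfx).
have [V RV] := side_surj RC NW.
have [[[oV _] _ _] [[_ cW] _ _]] := side_np RC RV.
have fW : (f @ x) W.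
  have VW : V `<=` f @^-1` W by move=> z /(fP _ _ _ RV).
  apply: (filterS VW); apply: open_nbhs_nbhs; split => //.
  by rewrite (fP _ _ _ RV).
have [|z [Wz nWz]] := cly _ (~` W) fW; last exact: nWz.
by apply: open_nbhs_nbhs; split => //; exact: closed_openC.
Qed.

Lemma side_map_cancel (T T' : topologicalType) (R : set T -> set T' -> Prop)
    (f : T -> T') (g : T' -> T) :
  stone_space T -> card_gt T 3 -> side_correspondence R ->
  (forall U U' x, R U U' -> U x <-> U' (f x)) ->
  (forall U U' y, R U U' -> U' y <-> U (g y)) -> cancel f g.
Proof.
move=> sT T3 RC fP gP x; apply: contrapT => gfx.
have [U [NU Ux]] := nonperipheral_separates sT T3 (nesym gfx).
have [U' RU] := side_total RC NU.
by apply; apply/(gP _ _ _ RU)/(fP _ _ _ RU).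
Qed.

Lemma side_correspondence_homeomorphism (T T' : topologicalType)
    (R : set T -> set T' -> Prop) :
  stone_space T -> stone_space T' -> card_gt T 3 -> card_gt T' 3 ->
  side_correspondence R ->
  triple_preserving R -> triple_preserving (fun U' U => R U U') ->
  exists f : T -> T',
    homeomorphism f /\ (forall U U', R U U' -> f @` U = U').
Proof.
move=> sT sT' T3 T3' RC R3 R3'.
have RC' := side_correspondence_sym RC.
have [f fP] := side_correspondence_map sT sT' T3 RC R3 R3'.
have [g gP] := side_correspondence_map sT' sT T3' RC' R3' R3.
have gP' U U' y : R U U' -> U' y <-> U (g y) by move=> RU; exact: gP.
have fK : cancel f g by exact: side_map_cancel RC fP gP'.
have gK : cancel g f by apply: side_map_cancel RC' gP _ => // U U' y; exact: fP.
exists f; split.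
  exists g; split => //; first exact: side_map_continuous RC fP.
  exact: side_map_continuous RC' gP.
move=> U U' RU; apply/seteqP; split => [_ [x Ux <-]|y U'y].
  exact/(fP _ _ _ RU).
by exists (g y); [exact/(gP _ _ _ RU)|exact: gK].
Qed.

(** * Inclusion determines triple intersections *)

Definition order_preserving (T T' : Type) (R : set T -> set T' -> Prop) : Prop :=
  forall U V U' V', R U U' -> R V V' -> U `<=` V -> U' `<=` V'.

(** [d] stands in for [a] when [A] is empty. *)
Lemma not_two_points_sub1 (T : Type) (A : set T) (d : T) :
  ~ at_least_two_points A -> exists a, A `<=` [set a].
Proof.
move=> A1; have [[a Aa]|A0] := pselect (A !=set0).
  by exists a => z Az; apply: contrapT => za; apply: A1; exists z, a.
by exists d => z Az; case: A0; exists z.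
Qed.

(** Disjointness of [U'] and [V'] is inclusion of [U'] in the complement of [V'], which passes back
    to [U] and [V]. *)
Lemma order_preserving_meet (T T' : topologicalType)
    (R : set T -> set T' -> Prop) (U V : set T) (U' V' : set T') :
  side_correspondence R -> order_preserving (fun U' U => R U U') ->
  R U U' -> R V V' -> U `&` V !=set0 -> U' `&` V' !=set0.
Proof.
move=> RC mono' RU RV [x [Ux Vx]]; apply: contrapT => UV0.
suff : U `<=` ~` V by move=> /(_ x Ux).
apply: mono' (RU) (side_compl RC RV) _ => y U'y V'y.
by apply: UV0; exists y.
Qed.

(** The intersection of [U] and [V] is itself nonperipheral; its image [M] lies in [U'] and [V'],
    and meets [W'] by the case of two sets. *)
Lemma order_preserving_triple_of_meet (T T' : topologicalType)
    (R : set T -> set T' -> Prop) (U V W : set T) (U' V' W' : set T') :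
  side_correspondence R ->
  order_preserving R -> order_preserving (fun U' U => R U U') ->
  R U U' -> R V V' -> R W W' -> U `&` V `&` W !=set0 ->
  at_least_two_points (U `&` V) -> U' `&` V' `&` W' !=set0.
Proof.
move=> RC mono mono' RU RV RW UVW UV2.
have [NU _] := side_np RC RU; have [NV _] := side_np RC RV.
have [M RM] := side_total RC (nonperipheralI NU NV UV2).
have [y [My Wy]] := order_preserving_meet RC mono' RM RW UVW.
exists y; split => //; split.
  by apply: (mono _ _ _ _ RM RU _ _ My) => ? [].
by apply: (mono _ _ _ _ RM RV _ _ My) => ? [].
Qed.

(* Otherwise [U `|` V] has an upper bound on the image side meeting [W'] in two
   points, although it meets [W] in at most one. *)
Lemma order_preserving_triple_of_join (T T' : topologicalType)
    (R : set T -> set T' -> Prop) (U V W : set T) (U' V' W' : set T') (x : T) :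
  side_correspondence R ->
  order_preserving R -> order_preserving (fun U' U => R U U') ->
  R U U' -> R V V' -> R W W' -> U x -> V x -> W x ->
  ~ at_least_two_points (U `&` W) -> ~ at_least_two_points (V `&` W) ->
  at_least_two_points (~` (U `|` V)) -> U' `&` V' `&` W' !=set0.
Proof.
move=> RC mono mono' RU RV RW Ux Vx Wx UW1 VW1 UV2.
have meet := order_preserving_meet RC mono'.
have [NU _] := side_np RC RU; have [NV _] := side_np RC RV.
have [_ NW] := side_np RC RW.
have [J RJ] := side_total RC (nonperipheralU NU NV UV2).
have UJ : U' `<=` J by apply: mono RU RJ _ => z; left.
have VJ : V' `<=` J by apply: mono RV RJ _ => z; right.
have [|y [Uy Wy]] := meet _ _ _ _ RU RW; first by exists x.
have [|z [Vz Wz]] := meet _ _ _ _ RV RW; first by exists x.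
have [yz|yz] := pselect (y = z); first by exists y; do !split => //; rewrite yz.
have JW2 : at_least_two_points (J `&` W').
  by exists y, z; do !split => //; [exact: UJ|exact: VJ].
have [_ NJ] := side_np RC RJ.
have [M RM] := side_surj RC (nonperipheralI NJ NW JW2).
have MUV : M `<=` U `|` V by apply: mono' RM RJ _ => ? [].
have MW : M `<=` W by apply: mono' RM RW _ => ? [].
have [[_ [p [q [Mp Mq pq]]] _] _] := side_np RC RM.
(* [M] lies in [W] and in the union of [U] and [V], each of which meets [W] in [x] alone. *)
have Mx m : M m -> m = x.
  move=> Mm; apply: contrapT => mx; have Wm := MW m Mm.
  by have [Um|Vm] := MUV m Mm; [apply: UW1|apply: VW1]; exists m, x.
by case: pq; rewrite (Mx _ Mp) (Mx _ Mq).
Qed.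

(** If the images had no common point, the two preceding lemmas would make any two of [U], [V], [W]
    meet only in [x] and cover all but at most one point. A fifth point [e], avoiding [x] and the
    three exceptions, lies in every union, hence in two of the sets, which is impossible. *)
Lemma order_preserving_triple (T T' : topologicalType)
    (R : set T -> set T' -> Prop) :
  card_gt T 4 -> side_correspondence R ->
  order_preserving R -> order_preserving (fun U' U => R U U') ->
  triple_preserving R.
Proof.
move=> T4 RC mono mono' U V W U' V' W' RU RV RW [x [[Ux Vx] Wx]].
have meet := order_preserving_triple_of_meet RC mono mono'.
have join := order_preserving_triple_of_join RC mono mono'.
apply: contrapT => UVW0.
have UV1 : ~ at_least_two_points (U `&` V).
  by move=> h; apply: UVW0; apply: meet RU RV RW _ h; exists x.
have UW1 : ~ at_least_two_points (U `&` W).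
  move=> h; apply: UVW0; rewrite setIAC.
  by apply: meet RU RW RV _ h; exists x.
have VW1 : ~ at_least_two_points (V `&` W).
  move=> h; apply: UVW0; rewrite -setIA setIC.
  by apply: meet RV RW RU _ h; exists x.
have [|a UVa] := @not_two_points_sub1 _ (~` (U `|` V)) x.
  by move=> h; apply: UVW0; exact: join RU RV RW Ux Vx Wx UW1 VW1 h.
have [|b UWb] := @not_two_points_sub1 _ (~` (U `|` W)) x.
  move=> h; apply: UVW0; rewrite setIAC.
  by apply: join RU RW RV Ux Wx Vx UV1 _ h; rewrite setIC.
have [|c VWc] := @not_two_points_sub1 _ (~` (V `|` W)) x.
  move=> h; apply: UVW0; rewrite -setIA setIC.
  by apply: join RV RW RU Vx Wx Ux _ _ h; rewrite setIC.
have [//|e] := T4 [:: x; a; b; c].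
rewrite !inE !negb_or => /and4P[/eqP ex /eqP ea /eqP eb /eqP ec].
have nUV : ~ (U e /\ V e).
  by move=> [Ue Ve]; apply: UV1; exists e, x.
have nUW : ~ (U e /\ W e).
  by move=> [Ue We]; apply: UW1; exists e, x.
have nVW : ~ (V e /\ W e).
  by move=> [Ve We]; apply: VW1; exists e, x.
have : (U `|` V) e by apply: contrapT => /UVa.
have : (U `|` W) e by apply: contrapT => /UWb.
have : (V `|` W) e by apply: contrapT => /VWc.
by rewrite /setU /=; tauto.
Qed.

(** * Nested and crossing cuts *)

Definition crossing (T : Type) (U V : set T) : Prop :=
  [/\ U `&` V !=set0, U `&` ~` V !=set0,
      ~` U `&` V !=set0 & ~` U `&` ~` V !=set0].

(** [K] relates each side of a cut to both sides of its image, so it encodes a bijection of cuts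
    without any choice of sides. *)
Record cut_correspondence (T T' : topologicalType)
    (K : set T -> set T' -> Prop) : Prop := CutCorrespondence {
  cut_np : forall U U', K U U' -> nonperipheral U /\ nonperipheral U';
  cut_total : forall U, nonperipheral U -> exists U', K U U';
  cut_surj : forall U', nonperipheral U' -> exists U, K U U';
  cut_complr : forall U U', K U U' -> K U (~` U');
  cut_compll : forall U U', K U U' -> K (~` U) U';
  cut_fun : forall U U' V', K U U' -> K U V' -> V' = U' \/ V' = ~` U';
  cut_inj : forall U V U', K U U' -> K V U' -> V = U \/ V = ~` U;
  cut_cross : forall U V U' V', K U U' -> K V V' -> crossing U V -> crossing U' V';
  cut_cross' : forall U V U' V', K U U' -> K V V' -> crossing U' V' -> crossing U V }.

Lemma cut_correspondence_sym (T T' : topologicalType)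
    (K : set T -> set T' -> Prop) :
  cut_correspondence K -> cut_correspondence (fun U' U => K U U').
Proof.
case=> np tot surj Cr Cl kfun kinj cr cr'; split.
- by move=> ? ? /np [].
- by [].
- by [].
- by move=> ? ? /Cl.
- by move=> ? ? /Cr.
- by move=> U' U V KU KV; exact: kinj KU KV.
- by move=> U' V' U KU KV; exact: kfun KU KV.
- by move=> ? ? ? ? KU KV; exact: cr' KU KV.
- by move=> ? ? ? ? KU KV; exact: cr KU KV.
Qed.

Lemma crossingCr (T : Type) (U V : set T) : crossing U V -> crossing U (~` V).
Proof. by case=> ? ? ? ?; split; rewrite ?setCK. Qed.

Lemma crossing_sym (T : Type) (U V : set T) : crossing U V -> crossing V U.
Proof. by case=> ? ? ? ?; split; rewrite setIC. Qed.

Lemma crossingCl (T : Type) (U V : set T) : crossing U V -> crossing (~` U) V.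
Proof. by move=> /crossing_sym/crossingCr/crossing_sym. Qed.

(** Invariant under complementing [A] but not [U]: a relation between the unoriented cut of [A] and
    the cut of [U] oriented by [U]. *)
Definition nested_in (T : Type) (U A : set T) : Prop :=
  [/\ A `<=` U \/ ~` A `<=` U, A <> U & A <> ~` U].

Lemma nested_inC (T : Type) (U A : set T) : nested_in U A -> nested_in U (~` A).
Proof.
case=> AU nAU nAC; split; first by rewrite setCK; tauto.
  by move=> E; apply: nAC; rewrite -E setCK.
by move/(congr1 setC); rewrite !setCK.
Qed.

Lemma subset_or_compl_sub (T : Type) (U A : set T) :
  ~ crossing U A ->
  [\/ A `<=` U, ~` A `<=` U, A `<=` ~` U | ~` A `<=` ~` U].
Proof.
move=> ncr.
have sub0 (X Y : set T) : ~ (X `&` Y !=set0) -> Y `<=` ~` X.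
  by move=> XY z Yz Xz; apply: XY; exists z.
have [h|/sub0] := pselect (U `&` A !=set0); last by constructor 3.
have [h1|/sub0] := pselect (U `&` ~` A !=set0); last by constructor 4.
have [h2|/sub0] := pselect (~` U `&` A !=set0); last first.
  by rewrite setCK; constructor 1.
have [h3|/sub0] := pselect (~` U `&` ~` A !=set0); last first.
  by rewrite setCK; constructor 2.
by exfalso; apply: ncr; split.
Qed.

Lemma nested_in_not_crossing (T : Type) (U A : set T) :
  nested_in U A -> ~ crossing U A.
Proof.
case=> -[AU|AU] _ _ [_ _ [x [nUx Ax]] [y [nUy nAy]]]; first exact/nUx/AU.
exact/nUy/AU.
Qed.

Lemma nested_in_opposite_not_crossing (T : Type) (U A B : set T) :
  nested_in U A -> nested_in (~` U) B -> ~ crossing A B.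
Proof.
move=> [AU _ _] [BU _ _] [[a [Aa Ba]] [b [Ab Bb]] [c [Ac Bc]] [d [Ad Bd]]].
case: AU => AU; case: BU => BU.
- exact: BU a Ba (AU a Aa).
- exact: BU b Bb (AU b Ab).
- exact: BU c Bc (AU c Ac).
- exact: BU d Bd (AU d Ad).
Qed.

(** Lying on both sides would make [A] or its complement empty, or make [A] equal to [U] or to its
    complement. *)
Lemma nested_in_exclusive (T : Type) (U A : set T) :
  A !=set0 -> ~` A !=set0 -> nested_in U A -> ~ nested_in (~` U) A.
Proof.
move=> [a Aa] [b nAb] [AU nAU nAC] [AU' _ _].
case: AU => AU; case: AU' => AU'.
- exact: AU' a Aa (AU a Aa).
- apply: nAU; apply/seteqP; split => // x Ux; apply: contrapT => nAx.
  exact: AU' x nAx Ux.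
- apply: nAC; apply/seteqP; split => // x nUx; apply: contrapT => nAx.
  exact/nUx/AU.
- exact: AU' b nAb (AU b nAb).
Qed.

Lemma nonperipheral_proper_part (T : topologicalType) (A : set T) :
  zero_dimensional T -> clopen A -> at_least_two_points A ->
  exists A1, [/\ clopen A1, A1 `<=` A, A1 !=set0 & A `&` ~` A1 !=set0].
Proof.
move=> zT cA [x [y [Ax Ay /eqP xy]]]; have [C [cC Cx nCy]] := zT x y xy.
exists (A `&` C); split.
- exact: clopenI.
- by move=> ? [].
- by exists x.
- by exists y; split => // -[].
Qed.

(** [C] joins a proper clopen part of [A] to one of [B]: it splits both sets and contains points
    outside each, while the complement of [U] avoids all three. *)
Lemma crossing_disjoint (T : topologicalType) (U A B : set T) :
  zero_dimensional T -> nonperipheral U -> nonperipheral A -> nonperipheral B ->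
  A `<=` U -> B `<=` U -> A `&` B = set0 ->
  exists C, [/\ nonperipheral C, nested_in U C, crossing A C & crossing B C].
Proof.
move=> zT [cU U2 nU2] [cA A2 _] [cB B2 _] AU BU AB0.
have [A1 [cA1 A1A [a A1a] [a' [Aa' nA1a']]]] := nonperipheral_proper_part zT cA A2.
have [B1 [cB1 B1B [b B1b] [b' [Bb' nB1b']]]] := nonperipheral_proper_part zT cB B2.
have AB z : A z -> B z -> False by move=> Az Bz; have : set0 z by rewrite -AB0.
have [u [v [nUu nUv uv]]] := nU2.
have CU : A1 `|` B1 `<=` U by move=> z [/A1A/AU|/B1B/BU].
exists (A1 `|` B1); split.
- split; first exact: clopenU.
    exists a, b; split; [by left|by right|].
    by move=> ab; apply: (AB a); [exact: A1A|rewrite ab; exact: B1B].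
  by apply: at_least_two_points_subset nU2; exact: subsetC.
- split; first by left.
    move=> E; have : (A1 `|` B1) a' by rewrite E; exact: AU.
    by case=> // /B1B; exact: AB.
  move=> E; have : (~` U) a by rewrite -E; left.
  by apply; apply/AU/A1A.
- split.
  + by exists a; split; [exact: A1A|left].
  + by exists a'; split => // -[//|/B1B]; exact: AB.
  + by exists b; split; [move=> Ab; exact: AB Ab (B1B b B1b)|right].
  + by exists u; split=> [/AU|/CU].
- split.
  + by exists b; split; [exact: B1B|right].
  + by exists b'; split => // -[/A1A|//] Ab'; exact: AB Ab' Bb'.
  + by exists a; split; [move=> Ba; exact: AB (A1A a A1a) Ba|left].
  + by exists u; split=> [/BU|/CU].
Qed.

(** [C] is a proper clopen part of [A] together with the points of [U] outside [B], so it splits [A]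
    and [B] and reaches beyond both. *)
Lemma crossing_included (T : topologicalType) (U A B : set T) :
  zero_dimensional T -> nonperipheral U -> nonperipheral A -> nonperipheral B ->
  A `<=` B -> B `<=` U -> B <> U ->
  exists C, [/\ nonperipheral C, nested_in U C, crossing A C & crossing B C].
Proof.
move=> zT [cU U2 nU2] [cA A2 _] [cB B2 _] AB BU nBU.
have [A1 [cA1 A1A [a A1a] [a' [Aa' nA1a']]]] := nonperipheral_proper_part zT cA A2.
have [u [v [nUu nUv uv]]] := nU2.
have [c [Uc nBc]] : U `&` ~` B !=set0.
  apply: contrapT => UB0; apply: nBU; apply/seteqP; split => // z Uz.
  by apply: contrapT => nBz; apply: UB0; exists z.
pose C := A1 `|` (U `&` ~` B).
have CU : C `<=` U by move=> z [/A1A/AB/BU|[]].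
have nCa' : ~ C a' by move=> [//|[_]]; apply; exact: AB.
exists C; split.
- split.
  + by apply: clopenU => //; apply: clopenI => //; exact: clopenC.
  + exists a, c; split; [by left|by right|].
    by move=> ac; apply: nBc; rewrite -ac; apply/AB/A1A.
  + by apply: at_least_two_points_subset nU2; exact: subsetC.
- split; first by left.
    by move=> E; apply: nCa'; rewrite E; apply/BU/AB.
  move=> E; have : (~` U) a by rewrite -E; left.
  by apply; apply/BU/AB/A1A.
- split.
  + by exists a; split; [exact: A1A|left].
  + by exists a'.
  + by exists c; split; [move=> /AB|right].
  + by exists u; split=> [/AB/BU|/CU].
- split.
  + by exists a; split; [exact/AB/A1A|left].
  + by exists a'; split => //; exact: AB.
  + by exists c; split => //; right.
  + by exists u; split=> [/BU|/CU].
Qed.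

Lemma nested_in_crossing_both (T : topologicalType) (U A B : set T) :
  zero_dimensional T -> nonperipheral U -> nonperipheral A -> nonperipheral B ->
  nested_in U A -> nested_in U B -> ~ crossing A B ->
  exists C, [/\ nonperipheral C, nested_in U C, crossing A C & crossing B C].
Proof.
move=> zT NU.
wlog AU : A / A `<=` U.
  move=> wl NA NB nA nB ncr; have [[AU|AU] _ _] := nA; first exact: wl.
  have [|||C [? ? cA ?]] := wl _ AU _ NB _ nB.
  - exact: nonperipheralC.
  - exact: nested_inC.
  - by move/crossingCl; rewrite setCK.
  by exists C; split => //; move/crossingCl: cA; rewrite setCK.
wlog BU : B / B `<=` U.
  move=> wl NA NB nA nB ncr; have [[BU|BU] _ _] := nB; first exact: wl.
  have [|||C [? ? ? cB]] := wl _ BU NA _ nA.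
  - exact: nonperipheralC.
  - exact: nested_inC.
  - by move/crossingCr; rewrite setCK.
  by exists C; split => //; move/crossingCl: cB; rewrite setCK.
(* Both sets now lie in [U], so points outside [U] are outside both; as the cuts do not cross, the
   sets are comparable or disjoint. *)
move=> NA NB [_ nAU _] [_ nBU _] ncr.
have [AB|nAB] := pselect (A `<=` B); first exact: crossing_included.
have [BA|nBA] := pselect (B `<=` A).
  have [C [? ? ? ?]] := crossing_included zT NU NB NA BA AU nAU.
  by exists C.
apply: crossing_disjoint => //; apply/seteqP; split => // z [Az Bz].
apply: ncr; have [_ _ [u [_ [nUu _ _]]]] := NU; split.
- by exists z.
- by move/existsNP: nAB => [y /not_implyP [? ?]]; exists y.
- by move/existsNP: nBA => [y /not_implyP [? ?]]; exists y.
- by exists u; split => [/AU|/BU].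
Qed.

(** * Orienting cuts when there are at least five points *)

Lemma nested_in_transport (T T' : topologicalType)
    (K : set T -> set T' -> Prop) (U A : set T) (U' A' : set T') :
  cut_correspondence K -> K U U' -> K A A' -> nested_in U A ->
  nested_in U' A' \/ nested_in (~` U') A'.
Proof.
move=> KC KU KA nA; have [_ nAU nAC] := nA.
have ncr : ~ crossing U' A'.
  by move/(cut_cross' KC KU KA); exact: nested_in_not_crossing.
have nAU' : A' <> U'.
  by move=> E; rewrite E in KA; case: (cut_inj KC KU KA).
have nAC' : A' <> ~` U'.
  by move=> E; rewrite E in KA; case: (cut_inj KC (cut_complr KC KU) KA).
by case: (subset_or_compl_sub ncr) => h;
  [left|left|right|right]; split; rewrite ?setCK; tauto.
Qed.

(** Cuts on opposite sides never cross, so crossing cuts cannot be carried to opposite sides;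
    non-crossing [A] and [B] are linked through a cut [C] crossing both. *)
Lemma nested_in_same_side (T T' : topologicalType)
    (K : set T -> set T' -> Prop) (U A B : set T) (U' A' B' : set T') :
  zero_dimensional T -> cut_correspondence K ->
  K U U' -> K A A' -> K B B' -> nested_in U A -> nested_in U B ->
  nested_in U' A' -> nested_in U' B'.
Proof.
move=> zT KC KU.
have crossing_case X Y X' Y' : K X X' -> K Y Y' -> nested_in U Y ->
    nested_in U' X' -> crossing X Y -> nested_in U' Y'.
  move=> KX KY nY nX' cXY; have [//|nY'] := nested_in_transport KC KU KY nY.
  exfalso; apply: (nested_in_opposite_not_crossing nX' nY').
  exact: cut_cross KC _ _ _ _ KX KY cXY.
move=> KA KB nA nB nA'.
have [cAB|ncAB] := pselect (crossing A B); first exact: crossing_case KA KB nB nA' cAB.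
have [NU _] := cut_np KC KU; have [NA _] := cut_np KC KA.
have [NB _] := cut_np KC KB.
have [C [NC nC cAC cBC]] := nested_in_crossing_both zT NU NA NB nA nB ncAB.
have [C' KC'] := cut_total KC NC.
have nC' := crossing_case _ _ _ _ KA KC' nC nA' cAC.
exact: crossing_case KC' KB nB nC' (crossing_sym cBC).
Qed.

(** Orients [K]: of the two sides of the image cut, it selects the one receiving the cuts nested in
    [U]. *)
Definition same_side (T T' : topologicalType) (K : set T -> set T' -> Prop)
    (U : set T) (U' : set T') : Prop :=
  K U U' /\ forall A A', K A A' ->
    (nested_in U A <-> nested_in U' A') /\
    (nested_in (~` U) A <-> nested_in (~` U') A').

Lemma same_side_sym (T T' : topologicalType) (K : set T -> set T' -> Prop) :
  (fun U' U => same_side K U U') = same_side (fun U' U => K U U').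
Proof.
apply/funext => U'; apply/funext => U; apply/propext.
by split=> -[KU h]; split => // A A' KA; have [h1 h2] := h _ _ KA; split; symmetry.
Qed.

Lemma same_sideC (T T' : topologicalType) (K : set T -> set T' -> Prop)
    (U : set T) (U' : set T') :
  cut_correspondence K -> same_side K U U' -> same_side K (~` U) (~` U').
Proof.
move=> KC [KU h]; split; first exact/(cut_compll KC)/(cut_complr KC).
by move=> A A' /h [h1 h2]; rewrite !setCK.
Qed.

(** One nested cut fixes the orientation: the other cuts on its side follow it in both directions,
    and the remaining compatible cuts are on the opposite side. *)
Lemma same_side_of_nested (T T' : topologicalType)
    (K : set T -> set T' -> Prop) (U A : set T) (U' A' : set T') :
  zero_dimensional T -> zero_dimensional T' -> cut_correspondence K ->
  K U U' -> K A A' -> nested_in U A -> nested_in U' A' -> same_side K U U'.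
Proof.
move=> zT zT' KC KU KA nA nA'; split=> // B B' KB.
have KCs := cut_correspondence_sym KC.
have in_in : nested_in U B -> nested_in U' B'.
  by move=> nB; exact: nested_in_same_side KU KA KB nA nB nA'.
have in_in' : nested_in U' B' -> nested_in U B.
  by move=> nB'; apply: (nested_in_same_side (K := fun U' U => K U U')) nA' nB' nA.
have [[_ [b [_ [Bb _ _]]] [c [_ [nBc _ _]]]] NB'] := cut_np KC KB.
have [_ [b' [_ [Bb' _ _]]] [c' [_ [nBc' _ _]]]] := NB'.
split; first by split.
split=> nB.
  have [] // := nested_in_transport KC (cut_compll KC KU) KB nB.
  move/in_in' => nB1; exfalso; apply: nested_in_exclusive nB1 nB; by [exists b|exists c].
have [] // := nested_in_transport KCs (cut_complr KC KU) KB nB.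
move/in_in => nB1; exfalso; apply: nested_in_exclusive nB1 nB; by [exists b'|exists c'].
Qed.

(** With five points some side of the cut has three, and separating two of them from the third gives
    a smaller nonperipheral set inside that side. *)
Lemma exists_nested_in (T : topologicalType) (U : set T) :
  zero_dimensional T -> card_gt T 4 -> nonperipheral U ->
  exists A, nonperipheral A /\ (nested_in U A \/ nested_in (~` U) A).
Proof.
move=> zT T4 NU.
have three (V : set T) x y e : nonperipheral V -> V x -> V y -> V e -> x <> y ->
    x <> e -> y <> e -> exists A, nonperipheral A /\ nested_in V A.
  move=> NV Vx Vy Ve xy xe ye.
  have [C [cC [Cx Cy nCe _]]] := clopen_separates_pairs zT xe xe ye ye.
  have [cV V2 nV2] := NV.
  have VC2 : at_least_two_points (V `&` C) by exists x, y.
  exists (V `&` C); split.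
    split=> //; first exact: clopenI.
    by apply: at_least_two_points_subset nV2; apply: subsetC => ? [].
  split; first by left => ? [].
    by move=> E; move: Ve; rewrite -E => -[].
  by move=> E; have [] : (~` V) x by rewrite -E.
have [_ [x [y [Ux Uy xy]]] [u [v [nUu nUv uv]]]] := NU.
have [//|e] := T4 [:: x; y; u; v].
rewrite !inE !negb_or => /and4P[/eqP ex /eqP ey /eqP eu /eqP ev].
have [Ue|nUe] := pselect (U e).
  have [A [NA nA]] := three U x y e NU Ux Uy Ue xy (nesym ex) (nesym ey).
  by exists A; split => //; left.
have [A [NA nA]] :=
  three _ u v e (nonperipheralC NU) nUu nUv nUe uv (nesym eu) (nesym ev).
by exists A; split => //; right.
Qed.

Lemma same_side_total (T T' : topologicalType) (K : set T -> set T' -> Prop)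
    (U : set T) :
  zero_dimensional T -> zero_dimensional T' -> card_gt T 4 ->
  cut_correspondence K -> nonperipheral U -> exists U', same_side K U U'.
Proof.
move=> zT zT' T4 KC NU; have [A [NA nA]] := exists_nested_in zT T4 NU.
have [A' KA] := cut_total KC NA.
have aux V : nonperipheral V -> nested_in V A -> exists V', same_side K V V'.
  move=> NV nVA; have [V' KV] := cut_total KC NV.
  have [nA'|nA'] := nested_in_transport KC KV KA nVA.
    by exists V'; exact: same_side_of_nested KV KA nVA nA'.
  by exists (~` V'); apply: same_side_of_nested (cut_complr KC KV) KA nVA nA'.
case: nA => nA; first exact: aux.
have [V' SV] := aux _ (nonperipheralC NU) nA.
by exists (~` V'); rewrite -[U]setCK; exact: same_sideC.
Qed.

Lemma same_side_order_preserving (T T' : topologicalType)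
    (K : set T -> set T' -> Prop) :
  zero_dimensional T -> card_gt T 4 -> cut_correspondence K ->
  order_preserving (same_side K).
Proof.
move=> zT T4 KC U V U' V' [KU hU] [KV hV] UV.
have [NU _] := cut_np KC KU; have [_ [x [_ [Ux _ _]]] _] := NU.
have [EUV|nUV] := pselect (U = V).
  rewrite -EUV in KV hV.
  (* Equal sets could only have equal or complementary images; in the latter case a cut [A] on one
     side of [U] would have its image on both sides of [U']. *)
  have [->//|EV'] := cut_fun KC KU KV.
  rewrite {}EV' in hV *; exfalso.
  have [A [NA nA]] := exists_nested_in zT T4 NU.
  have [A' KA] := cut_total KC NA.
  have [_ [_ [a [_ [Aa _ _]]] [b [_ [nAb _ _]]]]] := cut_np KC KA.
  have A0 : A' !=set0 by exists a.
  have nA0 : ~` A' !=set0 by exists b.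
  have [h1 h2] := hU _ _ KA; have [h3 h4] := hV _ _ KA.
  case: nA => nA; first exact: (nested_in_exclusive A0 nA0 (h1.1 nA) (h3.1 nA)).
  have := h4.1 nA; rewrite setCK => nA'.
  exact: (nested_in_exclusive A0 nA0 nA' (h2.1 nA)).
have nVU : nested_in V U.
  split=> //; first by left.
  by move=> E; move: (Ux); rewrite E; apply; exact: UV.
have nUV' : nested_in (~` U) V.
  split; first by right; exact: subsetC.
    by move=> E; have : V x by [exact: UV]; rewrite E.
  by rewrite setCK; exact: nesym.
(* Transporting both nestings leaves either the inclusion of [U'] in [V'] or [U'] being the
   complement of [V'], and nesting excludes the latter. *)
have [h1 _] := hV _ _ KU; have [_ h2] := hU _ _ KV.
have [[//|U'V] _ nU'V] := h1.1 nVU.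
have [[V'U|V'U] _ _] := h2.1 nUV'; last first.
  by rewrite -[U']setCK -[V']setCK; exact: subsetC.
exfalso; apply: nU'V; rewrite -[U']setCK; congr (~` _).
by apply/seteqP; split.
Qed.

Lemma same_side_correspondence (T T' : topologicalType)
    (K : set T -> set T' -> Prop) :
  zero_dimensional T -> zero_dimensional T' -> card_gt T 4 -> card_gt T' 4 ->
  cut_correspondence K -> side_correspondence (same_side K).
Proof.
move=> zT zT' T4 T4' KC; split.
- by move=> U U' [KU _]; exact: cut_np KU.
- by move=> U; exact: same_side_total.
- move=> U' NU'.
  have [U SU] := same_side_total zT' zT T4' (cut_correspondence_sym KC) NU'.
  by exists U; rewrite -same_side_sym in SU.
- by move=> U U'; exact: same_sideC.
Qed.

(** * Four points *)

Lemma not_card_gt_uniq (T : eqType) (n : nat) (s : seq T) :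
  ~ card_gt T n -> uniq s -> (size s <= n)%N.
Proof.
move=> /existsNP [t /not_implyP [tn all_t]] us.
apply: leq_trans tn; apply: uniq_leq_size => // x _.
by apply: contrapT => /negP xt; apply: all_t; exists x.
Qed.

Lemma no_five_points (T : eqType) (a b c d e : T) :
  ~ card_gt T 4 -> a <> b -> a <> c -> a <> d -> a <> e -> b <> c -> b <> d ->
  b <> e -> c <> d -> c <> e -> d <> e -> False.
Proof.
move=> T4 /eqP ab /eqP ac /eqP ad /eqP ae /eqP bc /eqP bd /eqP be /eqP cd /eqP ce /eqP de.
suff /(not_card_gt_uniq T4) : uniq [:: a; b; c; d; e] by [].
by rewrite /= !inE !negb_or ab ac ad ae bc bd be cd ce de.
Qed.

(** Two common points and one point from each of the three other regions would be five distinct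
    points. *)
Lemma crossing_meet1 (T : eqType) (U V : set T) (x y : T) :
  ~ card_gt T 4 -> crossing U V -> U x -> V x -> U y -> V y -> x = y.
Proof.
move=> T4 [_ [u [Uu nVu]] [v [nUv Vv]] [w [nUw nVw]]] Ux Vx Uy Vy.
apply: contrapT => xy.
by apply: (no_five_points (a := x) (b := y) (c := u) (d := v) (e := w)) => //;
  move=> E; subst; contradiction.
Qed.

(** Two points of [U], two outside [V] and one in between would be five. *)
Lemma nonperipheral_subset_eq (T : topologicalType) (U V : set T) :
  ~ card_gt T 4 -> nonperipheral U -> nonperipheral V -> U `<=` V -> U = V.
Proof.
move=> T4 [_ [x [y [Ux Uy xy]]] _] [_ _ [u [v [nVu nVv uv]]]] UV.
apply/seteqP; split => // c Vc; apply: contrapT => nUc.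
have Vx := UV x Ux; have Vy := UV y Uy.
by apply: (no_five_points (a := x) (b := y) (c := u) (d := v) (e := c)) => //;
  move=> E; subst; contradiction.
Qed.

Lemma nonperipheral_not_crossing_eq (T : topologicalType) (U V : set T) :
  ~ card_gt T 4 -> nonperipheral U -> nonperipheral V -> ~ crossing U V ->
  V = U \/ V = ~` U.
Proof.
move=> T4 NU NV /subset_or_compl_sub ncr.
have NCU := nonperipheralC NU; have NCV := nonperipheralC NV.
case: ncr => /(nonperipheral_subset_eq T4) h.
- by left; exact: h.
- by right; rewrite -h ?setCK.
- by right; exact: h.
- by left; rewrite -[V]setCK h ?setCK.
Qed.

(** Five points produce two distinct compatible cuts, whereas with at most four points compatible
    nonperipheral cuts coincide. *)
Lemma cut_correspondence_card_gt (T T' : topologicalType)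
    (K : set T -> set T' -> Prop) :
  stone_space T' -> cut_correspondence K ->
  card_gt T' 3 -> card_gt T' 4 -> card_gt T 4.
Proof.
move=> sT' KC T3' T4'; apply: contrapT => T4.
have zT' := stone_zero_dimensional sT'.
have [U' NU'] : exists U' : set T', nonperipheral U'.
  have [//|x _] := T3' [::]; have [//|y] := T3' [:: x].
  rewrite inE => /eqP yx.
  by have [U' [NU' _ _]] := nonperipheral_separates sT' T3' yx; exists U'.
have [A' [NA' nA']] := exists_nested_in zT' T4' NU'.
have [ncr nAU nAC] : [/\ ~ crossing U' A', A' <> U' & A' <> ~` U'].
  case: nA' => nA'; have [_ nA1 nA2] := nA'.
    by split => //; exact: nested_in_not_crossing.
  rewrite setCK in nA2; split => //.
  by move/crossingCl; exact: nested_in_not_crossing.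
have [U KU] := cut_surj KC NU'; have [A KA] := cut_surj KC NA'.
have [NU _] := cut_np KC KU; have [NA _] := cut_np KC KA.
have ncr' : ~ crossing U A by move/(cut_cross KC KU KA).
suff KUA : K U A' by case: (cut_fun KC KU KUA).
have [<-//|E] := nonperipheral_not_crossing_eq T4 NU NA ncr'.
by rewrite -[U]setCK -E; exact: cut_compll.
Qed.

(** With at most four points no nested cut is available to orient [K], so base points decide which
    sides are matched. *)
Definition based_side (T T' : Type) (K : set T -> set T' -> Prop) (a : T) (a' : T')
    (U : set T) (U' : set T') : Prop :=
  K U U' /\ (U a <-> U' a').

Lemma based_side_sym (T T' : Type) (K : set T -> set T' -> Prop) (a : T) (a' : T') :
  (fun U' U => based_side K a a' U U') = based_side (fun U' U => K U U') a' a.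
Proof.
apply/funext => U'; apply/funext => U; apply/propext.
by split=> -[KU h]; split => //; symmetry.
Qed.

Lemma based_side_total (T T' : topologicalType) (K : set T -> set T' -> Prop)
    (a : T) (a' : T') (U : set T) :
  cut_correspondence K -> nonperipheral U -> exists U', based_side K a a' U U'.
Proof.
move=> KC /(cut_total KC) [U' KU].
have [h|h] := pselect (U a <-> U' a'); first by exists U'.
exists (~` U'); split; first exact: cut_complr.
have [U'a|nU'a] := pselect (U' a').
  by split=> // Ua; exfalso; apply: h.
by split=> // _; apply: contrapT => nUa; apply: h.
Qed.

Lemma based_side_correspondence (T T' : topologicalType)
    (K : set T -> set T' -> Prop) (a : T) (a' : T') :
  cut_correspondence K -> side_correspondence (based_side K a a').
Proof.
move=> KC; split.
- by move=> U U' [KU _]; exact: cut_np KU.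
- by move=> U; exact: based_side_total.
- move=> U' NU'.
  have [U SU] := based_side_total a' a (cut_correspondence_sym KC) NU'.
  by exists U; rewrite -based_side_sym in SU.
- move=> U U' [KU h]; split; first exact/(cut_compll KC)/(cut_complr KC).
  by rewrite /setC /=; tauto.
Qed.

Lemma based_side_order_preserving (T T' : topologicalType)
    (K : set T -> set T' -> Prop) (a : T) (a' : T') :
  ~ card_gt T 4 -> cut_correspondence K -> order_preserving (based_side K a a').
Proof.
move=> T4 KC U V U' V' [KU hU] [KV hV] UV.
have [NU _] := cut_np KC KU; have [NV _] := cut_np KC KV.
have E := nonperipheral_subset_eq T4 NU NV UV.
rewrite -E in KV hV; have [->//|E'] := cut_fun KC KU KV.
by exfalso; move: hU hV; rewrite E' /setC /=; tauto.
Qed.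

(* Among three distinct pairs of points of a four-point set that share [x] and
   only one of which contains [a], the image of the latter has a point other
   than [a'], which the crossing relations place in the two other images. *)
Lemma based_side_triple_one (T T' : topologicalType)
    (K : set T -> set T' -> Prop) (a : T) (a' : T')
    (U V W : set T) (U' V' W' : set T') :
  ~ card_gt T' 4 -> cut_correspondence K ->
  based_side K a a' U U' -> based_side K a a' V V' -> based_side K a a' W W' ->
  U a -> ~ V a -> ~ W a -> crossing U V -> crossing U W ->
  U' `&` V' `&` W' !=set0.
Proof.
move=> T4' KC [KU hU] [KV hV] [KW hW] Ua nVa nWa cUV cUW.
have U'a := hU.1 Ua.
have nV'a : ~ V' a' by move/hV.2.
have nW'a : ~ W' a' by move/hW.2.
have [_ [_ [p [q [U'p U'q pq]]] _]] := cut_np KC KU.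
have [z [U'z za]] : exists z, U' z /\ z <> a'.
  have [pa|pa] := pselect (p = a'); last by exists p.
  by exists q; split => // qa; apply: pq; rewrite pa qa.
(* If [z] were outside [X'], both [z] and [a'] would lie in [U'] and outside [X'], a region with a
   single point. *)
have zin X' : crossing U' X' -> ~ X' a' -> X' z.
  move=> /crossingCr cr nXa; apply: contrapT => nXz; apply: za.
  exact: (crossing_meet1 T4' cr).
exists z; split; first split => //; apply: zin => //.
  exact: cut_cross KC _ _ _ _ KU KV cUV.
exact: cut_cross KC _ _ _ _ KU KW cUW.
Qed.

(** If two sets coincide, the case of two sets suffices; otherwise any two cross, hence meet only in
    [x]. Then [x] is [a], or exactly one set contains [a], or none does and [a], [x] and a further
    point of each set would be five points. *)
Lemma based_side_triple (T T' : topologicalType)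
    (K : set T -> set T' -> Prop) (a : T) (a' : T') :
  ~ card_gt T 4 -> ~ card_gt T' 4 -> cut_correspondence K ->
  triple_preserving (based_side K a a').
Proof.
move=> T4 T4' KC U V W U' V' W' RU RV RW [x [[Ux Vx] Wx]].
have RC := based_side_correspondence a a' KC.
have mono := based_side_order_preserving (a := a) (a' := a') T4 KC.
have mono' : order_preserving (fun U' U => based_side K a a' U U').
  rewrite based_side_sym; apply: based_side_order_preserving T4' _.
  exact: cut_correspondence_sym.
have meet := order_preserving_meet RC mono'.
have eqR X Y X' Y' : based_side K a a' X X' -> based_side K a a' Y Y' ->
    X = Y -> X' = Y'.
  move=> RX RY XY; rewrite XY in RX.
  by apply/seteqP; split; [exact: mono RX RY _|exact: mono RY RX _].
have [UV|UV] := pselect (U = V).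
  rewrite (eqR _ _ _ _ RU RV UV) setIid.
  by apply: meet RV RW _; exists x.
have [UW|UW] := pselect (U = W).
  rewrite (eqR _ _ _ _ RU RW UW) setIAC setIid.
  by apply: meet RW RV _; exists x.
have [VW|VW] := pselect (V = W).
  rewrite (eqR _ _ _ _ RV RW VW) -setIA setIid.
  by apply: meet RU RW _; exists x.
have cr X Y X' Y' : based_side K a a' X X' -> based_side K a a' Y Y' ->
    X x -> Y x -> X <> Y -> crossing X Y.
  move=> RX RY Xx Yx XY; apply: contrapT => ncr.
  have [NX _] := side_np RC RX; have [NY _] := side_np RC RY.
  have [E|E] := nonperipheral_not_crossing_eq T4 NX NY ncr; first exact: XY.
  by move: Yx; rewrite E; apply.
have cUV := cr _ _ _ _ RU RV Ux Vx UV.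
have cUW := cr _ _ _ _ RU RW Ux Wx UW.
have cVW := cr _ _ _ _ RV RW Vx Wx VW.
have inx : x = a -> U' `&` V' `&` W' !=set0.
  move=> E; rewrite E in Ux Vx Wx.
  by exists a'; split; [split; [exact/(RU.2)|exact/(RV.2)]|exact/(RW.2)].
have [xa|xa] := pselect (x = a); first exact: inx.
have [Ua|nUa] := pselect (U a).
  have nVa : ~ V a by move=> Va; apply: xa; exact: crossing_meet1 T4 cUV _ _ _ _.
  have nWa : ~ W a by move=> Wa; apply: xa; exact: crossing_meet1 T4 cUW _ _ _ _.
  exact: based_side_triple_one RU RV RW Ua nVa nWa cUV cUW.
have [Va|nVa] := pselect (V a).
  have nWa : ~ W a by move=> Wa; apply: xa; exact: crossing_meet1 T4 cVW _ _ _ _.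
  rewrite [U' `&` V']setIC.
  exact: based_side_triple_one RV RU RW Va nUa nWa (crossing_sym cUV) cVW.
have [Wa|nWa] := pselect (W a).
  rewrite setIC setIA.
  exact: based_side_triple_one RW RU RV Wa nUa nVa
    (crossing_sym cUW) (crossing_sym cVW).
have other X X' : based_side K a a' X X' -> X x -> exists y, X y /\ y <> x.
  move=> RX Xx; have [[_ [p [q [Xp Xq pq]]] _] _] := side_np RC RX.
  have [px|px] := pselect (p = x); last by exists p.
  by exists q; split => // qx; apply: pq; rewrite px qx.
have [u [Uu ux]] := other _ _ RU Ux.
have [v [Vv vx]] := other _ _ RV Vx.
have [w [Ww wx]] := other _ _ RW Wx.
have uv : u <> v.
  by move=> E; rewrite -E in Vv; apply: ux; exact: crossing_meet1 T4 cUV _ _ _ _.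
have uw : u <> w.
  by move=> E; rewrite -E in Ww; apply: ux; exact: crossing_meet1 T4 cUW _ _ _ _.
have vw : v <> w.
  by move=> E; rewrite -E in Ww; apply: vx; exact: crossing_meet1 T4 cVW _ _ _ _.
exfalso; apply: (no_five_points (a := a) (b := x) (c := u) (d := v) (e := w)) => //;
  by move=> E; subst.
Qed.

(** * The graph isomorphism as a correspondence of sides *)

(** Either both spaces have at least five points or neither does, so one orientation rule works in
    both directions. *)
Lemma cut_correspondence_sides (T T' : topologicalType)
    (K : set T -> set T' -> Prop) :
  stone_space T -> stone_space T' -> card_gt T 3 -> card_gt T' 3 ->
  cut_correspondence K ->
  exists R : set T -> set T' -> Prop,
    [/\ forall U U', R U U' -> K U U', side_correspondence R,
        triple_preserving R & triple_preserving (fun U' U => R U U')].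
Proof.
move=> sT sT' T3 T3' KC.
have KCs := cut_correspondence_sym KC.
have zT := stone_zero_dimensional sT; have zT' := stone_zero_dimensional sT'.
have [T4|T4] := pselect (card_gt T 4).
  have T4' := cut_correspondence_card_gt sT KCs T3 T4.
  have SC := same_side_correspondence zT zT' T4 T4' KC.
  have mono := same_side_order_preserving zT T4 KC.
  have mono' := same_side_order_preserving zT' T4' KCs.
  rewrite -same_side_sym in mono'.
  exists (same_side K); split => //; first by move=> ? ? [].
    exact: order_preserving_triple.
  exact: (order_preserving_triple T4' (side_correspondence_sym SC)).
have T4' : ~ card_gt T' 4.
  by move=> T4'; apply: T4; exact: cut_correspondence_card_gt KC T3' T4'.
have [//|a _] := T3 [::]; have [//|a' _] := T3' [::].
exists (based_side K a a'); split.
- by move=> ? ? [].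
- exact: based_side_correspondence.
- exact: based_side_triple.
- by rewrite based_side_sym; exact: based_side_triple.
Qed.

Lemma cut_vertexE (T : topologicalType) (P : cut_vertex T) (U : set T) :
  proj1_sig P U -> nonperipheral U /\ proj1_sig P = [set U; ~` U].
Proof.
case: P => P [[A [B [cA cB AB0 ABT PE]]] P2] /= PU.
have BE : B = ~` A.
  apply/seteqP; split => [z Bz Az|z nAz].
    by have : set0 z by rewrite -AB0.
  by have [] : (A `|` B) z by rewrite ABT.
have NA : nonperipheral A.
  by split => //; [apply: P2; rewrite PE; left|rewrite -BE; apply: P2; rewrite PE; right].
rewrite PE in PU *; rewrite BE in PU *.
case: PU => -> //; split; first exact: nonperipheralC.
by rewrite setCK setUC.
Qed.

Lemma cut_vertex_of (T : topologicalType) (U : set T) :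
  nonperipheral U -> exists P : cut_vertex T, proj1_sig P = [set U; ~` U].
Proof.
move=> [cU U2 nU2].
suff NP : nonperipheral_cut [set U; ~` U] by exists (exist _ _ NP).
split; last by move=> A [->|->].
by exists U, (~` U); split => //; [exact: clopenC|exact: setICr|exact: setUv].
Qed.

Lemma cut_vertex_eq (T : topologicalType) (P Q : cut_vertex T) (U : set T) :
  proj1_sig P U -> proj1_sig Q U -> P = Q.
Proof.
move=> /cut_vertexE [_ PE] /cut_vertexE [_ QE].
have {PE QE} : proj1_sig P = proj1_sig Q by rewrite PE QE.
case: P Q => [P hP] [Q hQ] /= PQ; rewrite PQ in hP *.
by congr exist; exact: Prop_irrelevance.
Qed.

Lemma cut_vertexC (T : topologicalType) (P : cut_vertex T) (U : set T) :
  proj1_sig P U -> proj1_sig P (~` U).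
Proof. by move=> /cut_vertexE [_ ->]; right. Qed.

Lemma cut_vertex_side (T : topologicalType) (P : cut_vertex T) (U V : set T) :
  proj1_sig P U -> proj1_sig P V -> V = U \/ V = ~` U.
Proof. by move=> /cut_vertexE [_ ->] [->|->]; [left|right]. Qed.

Lemma cuts_crossE (T : topologicalType) (P Q : cut_vertex T) (U V : set T) :
  proj1_sig P U -> proj1_sig Q V ->
  cuts_cross (proj1_sig P) (proj1_sig Q) <-> crossing U V.
Proof.
move=> PU QV; split=> [cr|].
  by split; apply: cr => //; exact: cut_vertexC.
have [_ ->] := cut_vertexE PU; have [_ ->] := cut_vertexE QV.
by case=> ? ? ? ? _ _ [->|->] [->|->].
Qed.

Lemma cuts_cross_irrefl (T : topologicalType) (P : cut_vertex T) :
  ~ cuts_cross (proj1_sig P) (proj1_sig P).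
Proof.
move=> cr; have [[A [B [_ _ AB0 _ PE]]] _] := proj2_sig P.
have [||x [Ax Bx]] := cr A B; [by rewrite PE; left|by rewrite PE; right|].
by have : set0 x by rewrite -AB0.
Qed.

Definition side_pair (T T' : topologicalType) (Phi : cut_vertex T -> cut_vertex T')
    (U : set T) (U' : set T') : Prop :=
  exists P, proj1_sig P U /\ proj1_sig (Phi P) U'.

Lemma side_pair_cut_correspondence (T T' : topologicalType)
    (Phi : cut_vertex T -> cut_vertex T') :
  cut_graph_iso Phi -> cut_correspondence (side_pair Phi).
Proof.
move=> [[Psi PhiK PsiK] adj].
(* No cut crosses itself, so crossing means distinct and not adjacent, which a graph isomorphism
   preserves. *)
have cross P Q : cuts_cross (proj1_sig P) (proj1_sig Q) <->
    cuts_cross (proj1_sig (Phi P)) (proj1_sig (Phi Q)).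
  split=> cr; apply: contrapT => ncr.
    have PQ : Phi P <> Phi Q.
      by move/(can_inj PhiK) => E; rewrite E in cr; exact: cuts_cross_irrefl cr.
    by have [_] := (adj P Q).2 (conj PQ ncr).
  have PQ : P <> Q by move=> E; rewrite E in cr; exact: cuts_cross_irrefl cr.
  by have [_] := (adj P Q).1 (conj PQ ncr).
split.
- by move=> U U' [P [/cut_vertexE [? _] /cut_vertexE [? _]]].
- move=> U /cut_vertex_of [P PE].
  have [[A [B [_ _ _ _ QE]]] _] := proj2_sig (Phi P).
  by exists A, P; rewrite PE QE; split; left.
- move=> U' /cut_vertex_of [P PE].
  have [[A [B [_ _ _ _ QE]]] _] := proj2_sig (Psi P).
  by exists A, (Psi P); rewrite PsiK PE QE; split; left.
- by move=> U U' [P [PU PU']]; exists P; split => //; exact: cut_vertexC.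
- by move=> U U' [P [PU PU']]; exists P; split => //; exact: cut_vertexC.
- move=> U U' V' [P [PU PU']] [Q [QU QV']].
  by rewrite -(cut_vertex_eq PU QU) in QV'; exact: cut_vertex_side PU' QV'.
- move=> U V U' [P [PU PU']] [Q [QV QU']].
  have /(can_inj PhiK) E := cut_vertex_eq PU' QU'.
  by rewrite -E in QV; exact: cut_vertex_side PU QV.
- move=> U V U' V' [P [PU PU']] [Q [QV QV']] cr.
  by apply/(cuts_crossE PU' QV')/cross/(cuts_crossE PU QV).
- move=> U V U' V' [P [PU PU']] [Q [QV QV']] cr.
  by apply/(cuts_crossE PU QV)/cross/(cuts_crossE PU' QV').
Qed.

Unset Implicit Arguments.
Set Strict Implicit.

Theorem mainTheorem12 (E E' : topologicalType)
  (hE : stone_space E) (hE' : stone_space E')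
  (scE : @second_countable E) (scE' : @second_countable E')
  (h4E : at_least_four_points E) (h4E' : at_least_four_points E')
  (Phi : cut_vertex E -> cut_vertex E')
  (hPhi : cut_graph_iso Phi) :
  exists f : E -> E',
    homeomorphism f /\
    (forall P : cut_vertex E, proj1_sig (Phi P) = cut_image f (proj1_sig P)).
Proof.
have E3 := four_points_card_gt h4E; have E3' := four_points_card_gt h4E'.
have KC := side_pair_cut_correspondence hPhi.
have [R [RK RC R3 R3']] := cut_correspondence_sides hE hE' E3 E3' KC.
have [f [hf fR]] := side_correspondence_homeomorphism hE hE' E3 E3' RC R3 R3'.
exists f; split => // P.
have [[U [V [_ _ _ _ PE]]] _] := proj2_sig P.
have PU : proj1_sig P U by rewrite PE; left.
have [NU PUE] := cut_vertexE PU.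
(* [R] orients the cut at [U]; compatibility with complements then identifies the other side of the
   image. *)
have [U' RU] := side_total RC NU.
have [Q [QU QU']] := RK _ _ RU; rewrite (cut_vertex_eq QU PU) in QU'.
have [_ ->] := cut_vertexE QU'.
rewrite PUE /cut_image image_setU !image_set1.
by rewrite (fR _ _ RU) (fR _ _ (side_compl RC RU)).
Qed.
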